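(* For fixed integers $p,q\ge 0$, $$\frac{A_{p,q}(i,j)}{A_{0,0}(p+i,q+j)}\ \longrightarrow\ \frac{1}{(p+q+1)!}$$ as both $i,j$ tend to infinity; that is, for every $\varepsilon>0$ there is $M$ such that the quotient differs from $\frac1{(p+q+1)!}$ by less than $\varepsilon$ for all $i,j\ge M$.
   Context: The Euler graph is the infinite directed multigraph with vertex set $\{(i,j): i,j\in\mathbb{Z}_{\ge 0}\}$, having exactly $j+1$ edges from $(i,j)$ to $(i+1,j)$ and exactly $i+1$ edges from $(i,j)$ to $(i,j+1)$, and no other edges. For integers $p,q,i,j\ge 0$, the generalized Eulerian number $A_{p,q}(i,j)$ is the number of directed paths (parallel edges distinguished) from $(p,q)$ to $(p+i,q+j)$ in the Euler graph. *)

(* Defs.v *)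
From mathcomp Require Import all_boot all_order all_algebra finmap.
From mathcomp Require Import mathcomp_extra boolp classical_sets functions.
From mathcomp Require Import cardinality reals.

Set Implicit Arguments.
Unset Strict Implicit.
Unset Printing Implicit Defensive.

Local Open Scope nat_scope.
Local Open Scope classical_set_scope.

Definition vertex : Type := (nat * nat)%type.

Definition euler_mult (u v : vertex) : nat :=
  if v == (u.1.+1, u.2) then u.2.+1
  else if v == (u.1, u.2.+1) then u.1.+1
  else 0.

(* An edge is a pair of endpoints (u, v) together with a label in
   'I_(euler_mult u v) that distinguishes the parallel edges from u to v. *)
Definition edge : Type := {uv : vertex * vertex & 'I_(euler_mult uv.1 uv.2)}.

Definition source (e : edge) : vertex := (tag e).1.
Definition target (e : edge) : vertex := (tag e).2.

Fixpoint dipath (u v : vertex) (s : seq edge) : bool :=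
  if s is e :: s' then (source e == u) && dipath (target e) v s' else u == v.

Definition dipaths (u v : vertex) : set (seq edge) := [set s | dipath u v s].

Lemma finite_out_edges (u : vertex) : finite_set [set e | source e = u].
Proof.
pose W := [set (u.1.+1, u.2)] `|` [set (u.1, u.2.+1)] : set vertex.
pose g v := fun k : 'I_(euler_mult u v) =>
  existT (fun uv : vertex * vertex => 'I_(euler_mult uv.1 uv.2)) (u, v) k.
apply: (@sub_finite_set _ _ (\bigcup_(v in W) range (@g v))).
  move=> [[u' v] k] /= uE; rewrite /source /= in uE; subst u'.
  exists v; last by exists k.
  case: k => k /=; rewrite /euler_mult.
  by case: eqP => [->|_]; [left | case: eqP => [->|//]; right].
apply: bigcup_finite; first by rewrite finite_setU; split; exact: finite_set1.
by move=> v _; apply: finite_image; exact: finite_finset.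
Qed.

Lemma dipath_size (u v : vertex) (s : seq edge) :
  dipath u v s -> u.1 + u.2 + size s = v.1 + v.2.
Proof.
elim: s u => [|e s IH] u /=; first by move/eqP=> ->; rewrite addn0.
case/andP=> /eqP <- /IH <-; rewrite addnS -addSn; congr (_ + _).
case: e => [[a b] [k]]; rewrite /source /target /= /euler_mult.
by case: eqP => [->|_]; [|case: eqP => [->|//]]; rewrite /= ?addnS ?addSn.
Qed.

(* [fset_set] sends infinite sets to the empty one; this lemma rules that out
   in [gen_eulerian]. *)
Lemma finite_dipaths (u v : vertex) : finite_set (dipaths u v).
Proof.
suff H n w : finite_set [set s | dipath w v s /\ size s = n].
  apply: sub_finite_set (H (v.1 + v.2 - (u.1 + u.2)) u) => s /= us.
  by split=> //; rewrite -(dipath_size us) addKn.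
elim: n w => [|n IH] w.
  by apply: (@sub_finite_set _ _ [set [::]]) => // s [_ /size0nil].
apply: (@sub_finite_set _ _ (\bigcup_(e in [set e | source e = w])
   (cons e @` [set s | dipath (target e) v s /\ size s = n]))).
  case=> [[]//|e s] [/= /andP[/eqP we es] [sn]].
  by exists e => //; exists s.
by apply: bigcup_finite (finite_out_edges w) _ => e _; apply: finite_image.
Qed.

Definition gen_eulerian (p q i j : nat) : nat :=
  #|` fset_set (dipaths (p, q) (p + i, q + j))|.

(* Main.v *)
Require Import Defs.
From mathcomp Require Import all_boot all_order all_algebra reals.
From mathcomp Require Import finmap boolp classical_sets cardinality.
From mathcomp Require Import ring zify.

Import Order.TTheory GRing.Theory Num.Theory.
Local Open Scope ring_scope.

(** Fix the endpoint (I, J) = (p + i, q + j) and let H(a, b) be the number of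
    paths from (a, b) to it, so that the quotient is H(p, q) / H(0, 0).
    Splitting a path at its first edge gives, away from the endpoint,
      H(a, b) = (b + 1) H(a + 1, b) + (a + 1) H(a, b + 1).
    The two coefficients add up to a + b + 2, so if H(a + 1, b) and
    H(a, b + 1) were equal, each would be H(a, b) / (a + b + 2), and following
    any path from (0, 0) to (p, q) would give H(p, q) = H(0, 0) / (p + q + 1)!.

    That they are almost equal comes from an identity for the difference
    S(a, b) = H(a + 1, b) - H(a, b + 1).  If neither (a + 1, b) nor (a, b + 1)
    is the endpoint, applying the recursion to both gives
      S(a, b) = (b + 1) S(a + 1, b) + (a + 1) S(a, b + 1),
    the recursion of H itself.  Hence an inequality of the form
    N |S(a, b)| <= (b + 1) H(a + 1, b) + (a + 1) H(a, b + 1) propagates down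
    from the level a + b + 1 = I + J.  There the two counts are 0 unless one of
    the two vertices is the endpoint; then that count is 1 and the other is 0,
    and the coefficient of the 1 is J + 1 or I + 1.  So N = min(I, J) + 1
    works; this is [paths_to_neighbours].

    Each step away from (0, 0) therefore costs a relative error of order 1/N.
    The errors telescope, and [paths_to_deviation] gives
    |H(p, q) / H(0, 0) - 1 / (p + q + 1)!| <= 1/N,
    which tends to 0 when I and J both tend to infinity. *)

(** * The first-edge recursion *)

(** The endpoint comes first: it stays fixed while the start varies. *)
Definition paths_to (v u : vertex) : nat := #|` fset_set (dipaths u v)|.

Lemma mem_fset_dipaths (u v : vertex) (s : seq edge) :
  (s \in fset_set (dipaths u v)) = dipath u v s.
Proof.
rewrite in_fset_set; last exact: finite_dipaths.
by apply/idP/idP; rewrite inE.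
Qed.

Definition edge_to {u w : vertex} (k : 'I_(euler_mult u w)) : edge :=
  existT (fun uv : vertex * vertex => 'I_(euler_mult uv.1 uv.2)) (u, w) k.

Lemma edge_to_inj (u w : vertex) : injective (@edge_to u w).
Proof. by move=> k l /eqP; rewrite -tag_eqE /tag_eq eqxx tagged_asE => /eqP. Qed.

Definition paths_via (v u w : vertex) : seq (seq edge) :=
  [seq edge_to k :: s | k <- enum 'I_(euler_mult u w),
                        s <- enum_fset (fset_set (dipaths w v))].

Lemma size_paths_via (v u w : vertex) :
  size (paths_via v u w) = (euler_mult u w * paths_to v w)%N.
Proof. by rewrite size_allpairs size_enum_ord. Qed.

Lemma uniq_paths_via (v u w : vertex) : uniq (paths_via v u w).
Proof.
apply: allpairs_uniq; [exact: enum_uniq | exact: fset_uniq |].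
move=> [k s] [l t] _ _ /= /eqP; rewrite eqseq_cons.
by case/andP=> /eqP /edge_to_inj -> /eqP ->.
Qed.

Lemma paths_viaP (v u w : vertex) (s : seq edge) :
  reflect (exists (k : 'I_(euler_mult u w)) (t : seq edge),
             s = edge_to k :: t /\ dipath w v t)
          (s \in paths_via v u w).
Proof.
apply: (iffP allpairsP) => [[[k t] /= [_ tv ->]]|[k [t [-> tv]]]].
  by exists k, t; rewrite -mem_fset_dipaths.
by exists (k, t); rewrite mem_enum mem_fset_dipaths.
Qed.

Lemma euler_mult_right (a b : nat) : euler_mult (a, b) (a.+1, b) = b.+1.
Proof. by rewrite /euler_mult eqxx. Qed.

Lemma euler_mult_up (a b : nat) : euler_mult (a, b) (a, b.+1) = a.+1.
Proof. by rewrite /euler_mult eqxx xpair_eqE /= ltn_eqF. Qed.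

(** The paths from [(a, b)] are the disjoint union of those whose first edge
    goes right and those whose first edge goes up; the path [[::]] is excluded
    because [(a, b)] is not the endpoint. *)
Lemma paths_to_rec (v : vertex) (a b : nat) : (a, b) != v ->
  paths_to v (a, b) =
    (b.+1 * paths_to v (a.+1, b) + a.+1 * paths_to v (a, b.+1))%N.
Proof.
move=> neq_v; have := size_paths_via v (a, b) (a.+1, b).
have := size_paths_via v (a, b) (a, b.+1).
rewrite euler_mult_right euler_mult_up => <- <-.
rewrite -size_cat; apply/perm_size/uniq_perm.
- exact: fset_uniq.
- rewrite cat_uniq !uniq_paths_via /= andbT; apply/hasPn => s.
  case/paths_viaP=> k [t [-> _]]; apply/negP.
  by case/paths_viaP=> l [t' [[]]] /eqP; rewrite ltn_eqF.
move=> s; rewrite mem_fset_dipaths mem_cat; apply/idP/orP; last first.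
  by case=> /paths_viaP [k [t [-> tv]]] /=; rewrite eqxx.
case: s => [/= /eqP eq_v|]; first by rewrite eq_v eqxx in neq_v.
move=> [[u w] k] t /= /andP[/eqP eq_u tv].
rewrite /source /= in eq_u; subst u; rewrite /target /= in tv.
have [eq_w|neq_w] := eqVneq w (a.+1, b).
  by left; apply/paths_viaP; subst w; exists k, t.
have [eq_w|neq_w'] := eqVneq w (a, b.+1).
  by right; apply/paths_viaP; subst w; exists k, t.
have : (0 < euler_mult (a, b) w)%N by exact: leq_ltn_trans (leq0n k) (ltn_ord k).
by rewrite /euler_mult (negbTE neq_w) (negbTE neq_w').
Qed.

(** Every edge raises the sum of the coordinates by one. *)
Lemma dipath_nil (u v : vertex) (s : seq edge) :
  (v.1 + v.2 <= u.1 + u.2)%N -> dipath u v s -> s = [::].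
Proof. by move=> le_vu /dipath_size sz; apply: size0nil; lia. Qed.

Lemma paths_to_eq0 (I J a b : nat) : (I + J <= a + b)%N -> (a, b) != (I, J) ->
  paths_to (I, J) (a, b) = 0%N.
Proof.
move=> le_ab neq; apply/eqP; rewrite cardfs_eq0; apply/eqP/fsetP=> s.
rewrite mem_fset_dipaths in_fset0; apply/negP => sP.
have s_nil := @dipath_nil (a, b) (I, J) s le_ab sP.
by move: sP neq; rewrite s_nil /= => ->.
Qed.

Lemma paths_to_target (v : vertex) : paths_to v v = 1%N.
Proof.
have -> : paths_to v v = #|` [fset [::] : seq edge]%fset|; last exact: cardfs1.
congr #|` _|; apply/fsetP=> s.
rewrite mem_fset_dipaths in_fset1; apply/idP/eqP => [sP|-> /=]; last exact/eqP.
exact: dipath_nil sP.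
Qed.

(** Prefixing a fixed path from the origin to [(a, b)] is injective; here this
    is read off the recursion, whose coefficients are positive.  With
    [(a, b) = (I, J)] it also shows that the count from the origin is not 0. *)
Lemma paths_to_le_origin (I J a b : nat) : (a <= I)%N -> (b <= J)%N ->
  (paths_to (I, J) (a, b) <= paths_to (I, J) (0%N, 0%N))%N.
Proof.
have neqP x y : (x < I)%N || (y < J)%N -> (x, y) != (I, J).
  by apply: contraTneq => -[-> ->]; rewrite !ltnn.
elim: a b => [|a IHa] b leI leJ; last first.
  apply: leq_trans (IHa b (ltnW leI) leJ).
  by rewrite (@paths_to_rec _ a) ?neqP ?leI //; lia.
elim: b leJ => [//|b IHb] leJ; apply: leq_trans (IHb (ltnW leJ)).
by rewrite (@paths_to_rec _ _ b) ?neqP ?leJ ?orbT //; lia.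
Qed.

(** * Nearly equal counts from neighbouring vertices *)

(** Below the level of the endpoint, the difference of the two counts obeys the
    recursion of the counts themselves, so the bound is inherited from the vertices [(a.+1, b)] and
    [(a, b.+1)], whose right-hand sides are again counts. *)
Lemma paths_to_neighbours (R : realDomainType) (I J M a b : nat) :
    (M <= I)%N -> (M <= J)%N ->
  M.+1%:R * `|(paths_to (I, J) (a.+1, b))%:R - (paths_to (I, J) (a, b.+1))%:R|
    <= b.+1%:R * (paths_to (I, J) (a.+1, b))%:R
       + a.+1%:R * (paths_to (I, J) (a, b.+1))%:R :> R.
Proof.
move=> MI MJ.
(* Induction on how far the level [a + b] is below that of the endpoint. *)
have [n] := ubnP (I + J - (a + b))%N; elim: n a b => [|n IHn] a b.
  by rewrite ltn0.
move=> ltn.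
set x : R := (paths_to _ (a.+1, b))%:R.
set y : R := (paths_to _ (a, b.+1))%:R.
have [x0 y0] : 0 <= x /\ 0 <= y by split; rewrite ler0n.
have [le_ab|gt_ab] := leqP (I + J)%N (a + b).+1.
  (* Both counts are 0 unless one of the vertices is the endpoint; its
     coefficient is then [J.+1] or [I.+1]. *)
  have [[eqI eqJ]|neq] := eqVneq (a.+1, b) (I, J).
    have -> : y = 0 by rewrite /y paths_to_eq0 ?addnS //; apply/eqP => -[]; lia.
    rewrite subr0 mulr0 addr0 ger0_norm //; apply: ler_wpM2r => //.
    by rewrite ler_nat eqJ.
  have -> : x = 0 by rewrite /x paths_to_eq0 ?addSn.
  have [[eqI eqJ]|neq'] := eqVneq (a, b.+1) (I, J).
    rewrite sub0r normrN mulr0 add0r ger0_norm //; apply: ler_wpM2r => //.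
    by rewrite ler_nat eqI.
  by rewrite /y paths_to_eq0 ?addnS // subrr normr0 !mulr0 addr0.
(* Neither vertex is the endpoint, so the recursion applies to both. *)
have xE := @paths_to_rec (I, J) a.+1 b.
have yE := @paths_to_rec (I, J) a b.+1.
have {}xE := xE ltac:(apply/eqP => -[]; lia).
have {}yE := yE ltac:(apply/eqP => -[]; lia).
have := IHn a.+1 b ltac:(lia); have := IHn a b.+1 ltac:(lia).
move: (paths_to (I, J) (a.+2, b)) (paths_to (I, J) (a.+1, b.+1))
  (paths_to (I, J) (a, b.+2)) xE yE => l m r xE yE Ly Lx.
rewrite -!natrM -!natrD -xE in Lx.
rewrite -!natrM -!natrD -yE in Ly.
have -> : x - y = b.+1%:R * (l%:R - m%:R) + a.+1%:R * (m%:R - r%:R).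
  by rewrite /x /y xE yE !natrD !natrM -!natr1; ring.
apply: (@le_trans _ _ (M.+1%:R *
   (b.+1%:R * `|l%:R - m%:R| + a.+1%:R * `|m%:R - r%:R|))).
  rewrite ler_wpM2l //; apply: le_trans (ler_normD _ _) _.
  by rewrite !normrM !normr_nat.
by rewrite mulrDr; apply: lerD; rewrite mulrCA ler_wpM2l.
Qed.

(** One step from a vertex to a neighbour: [h] is the count at the vertex, [x]
    the count at the neighbour, [y] the count at the other one, [W] the number
    of outgoing edges and [c] the number of those leading to [y].  Since
    [h - W * x = c * (y - x)], the step adds an error of at most [F * c * D],
    and [F + F * c <= W * F]: this is why the same factorial can multiply both
    sides of the bound. *)
Lemma deviation_step (R : realDomainType) (N F W c D h x y : R) :
    0 <= N -> 0 <= F -> 0 <= c -> c + 1 <= W -> 0 <= D ->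
    h = (W - c) * x + c * y -> N * `|x - y| <= h -> h <= D ->
    N * `|D - F * h| <= F * D ->
  N * `|D - W * F * x| <= W * F * D.
Proof.
move=> N0 F0 c0 cW D0 hE near hD dev.
have -> : D - W * F * x = (D - F * h) - F * c * (x - y) by rewrite hE; ring.
apply: (@le_trans _ _ (F * D + F * c * D)); last first.
  have -> : F * D + F * c * D = (c + 1) * (F * D) by ring.
  by rewrite -mulrA ler_wpM2r // mulr_ge0.
apply: (@le_trans _ _ (N * (`|D - F * h| + `|F * c * (x - y)|))).
  by rewrite ler_wpM2l // ler_normB.
rewrite mulrDr lerD // normrM ger0_norm ?mulr_ge0 // mulrCA.
by rewrite ler_wpM2l ?mulr_ge0 // (le_trans near).
Qed.

(** The path followed goes up from [(0, 0)] to [(0, q)], then right to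
    [(p, q)]; a step from level [m = a + b] multiplies the factorial by its
    number of outgoing edges, [m + 2]. *)
Lemma paths_to_deviation (R : realDomainType) (I J M p q : nat) :
    (M <= I)%N -> (M <= J)%N -> (p <= I)%N -> (q <= J)%N ->
  M.+1%:R * `|(paths_to (I, J) (0%N, 0%N))%:R
              - ((p + q + 1)`!)%:R * (paths_to (I, J) (p, q))%:R|
    <= ((p + q + 1)`!)%:R * (paths_to (I, J) (0%N, 0%N))%:R :> R.
Proof.
move=> MI MJ leI leJ; set D : R := (paths_to _ (0%N, 0%N))%:R.
have D0 : 0 <= D by [].
elim: p q leI leJ => [|p IHp] q leI leJ.
  elim: q leJ => [|q IHq] leJ.
    by rewrite !mul1r subrr normr0 mulr0.
  have neq : (0%N, q) != (I, J) by apply/eqP => -[]; lia.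
  rewrite (_ : 0 + q.+1 + 1 = (0 + q + 1).+1)%N; last by lia.
  rewrite factS natrM.
  apply: (@deviation_step _ _ _ _ q.+1%:R _ (paths_to (I, J) (0%N, q))%:R _
            (paths_to (I, J) (1%N, q))%:R) => //.
  - by rewrite natr1 ler_nat; lia.
  - rewrite paths_to_rec // natrD !natrM addrC; congr (_ * _ + _).
    by rewrite -natrB; [congr (_%:R); lia | lia].
  - rewrite distrC (@paths_to_rec _ 0 q) // natrD !natrM.
    exact: paths_to_neighbours.
  - by rewrite ler_nat paths_to_le_origin // ltnW.
  - exact: IHq (ltnW leJ).
have neq : (p, q) != (I, J) by apply/eqP => -[]; lia.
rewrite addSn addSn factS natrM.
apply: (@deviation_step _ _ _ _ p.+1%:R _ (paths_to (I, J) (p, q))%:R _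
          (paths_to (I, J) (p, q.+1))%:R) => //.
- by rewrite natr1 ler_nat; lia.
- rewrite paths_to_rec // natrD !natrM; congr (_ * _ + _).
  by rewrite -natrB; [congr (_%:R); lia | lia].
- rewrite (@paths_to_rec _ p q) // natrD !natrM.
  exact: paths_to_neighbours.
- by rewrite ler_nat paths_to_le_origin // ltnW.
- exact: IHp (ltnW leI) leJ.
Qed.

(** * The limit *)

Theorem theorem7p4 (R : realType) (p q : nat) (eps : R) (eps_gt0 : 0 < eps) :
  exists M : nat, forall i j : nat, (M <= i)%N -> (M <= j)%N ->
    `| (gen_eulerian p q i j)%:R / (gen_eulerian 0 0 (p + i) (q + j))%:R
       - ((p + q + 1)`!)%:R^-1 | < eps.
Proof.
have [M epsM] : exists M : nat, eps^-1 < M.+1%:R.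
  exists (Num.trunc eps^-1); exact: Num.Theory.truncnS_gt.
exists M => i j Mi Mj.
rewrite -[gen_eulerian p q i j]/(paths_to (p + i, q + j)%N (p, q)).
rewrite -[gen_eulerian _ _ _ _]/(paths_to (p + i, q + j)%N (0%N, 0%N)).
have := @paths_to_deviation R (p + i) (q + j) M p q.
move=> /(_ (leq_trans Mi (leq_addl _ _)) (leq_trans Mj (leq_addl _ _))
           (leq_addr _ _) (leq_addr _ _)).
have /(@paths_to_le_origin (p + i) (q + j)) : (p + i <= p + i)%N by [].
move=> /(_ (q + j)%N (leqnn _)); rewrite paths_to_target => D_gt0.
have F_gt0 : (0 < (p + q + 1)`!)%N := fact_gt0 _.
move: D_gt0 F_gt0; rewrite -!(ltr_nat R).
set D : R := (paths_to _ (0%N, 0%N))%:R; set h : R := (paths_to _ _)%:R.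
set F : R := ((p + q + 1)`!)%:R => D_gt0 F_gt0 dev.
have -> : h / D - F^-1 = - (D - F * h) / (F * D).
  by field; rewrite !gt_eqF.
rewrite normrM normrN normfV (gtr0_norm (mulr_gt0 F_gt0 D_gt0)).
rewrite ltr_pdivrMr ?mulr_gt0 //.
have N_gt0 : 0 < M.+1%:R :> R by rewrite ltr0n.
rewrite -(ltr_pM2l N_gt0); apply: le_lt_trans dev _.
rewrite mulrA -[ltLHS]mul1r ltr_pM2r ?mulr_gt0 //.
by rewrite -ltr_pdivrMr // div1r.
Qed.
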